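(* Let $S$ be a semigroup with left cancellation law, let $I$ be a nonzero proper right ideal of $S$, and suppose that $S$ is right $P_r(I)$-comparable. Let $J=J(S)$ be the set of non-units of $S$. Then the following conditions are equivalent: (i) $P_r(I)\subseteq J$. (ii) There exist a completely prime right ideal $P$ of $S$ contained in $J$ and a subset $V$ of $S$ such that $I=\bigcap_{a\in V}aP$. (iii) There exist a completely prime right ideal $P$ of $S$ contained in $J$ and a subset $V'$ of $S$ such that $I=\bigcup_{a\in V'}(aS)T^{-1}$, where $T=S-P$. Furthermore, under these equivalent conditions, $I$ is a right waist.
   Context: ''Semigroup'' means a (not necessarily commutative) semigroup $S$ with unit element $1$ and zero element $0$, $1\neq 0$. $S$ has left cancellation law if for all $a,b,c\in S$, $ab=ac\neq 0$ implies $b=c$. $\subset$ denotes proper inclusion, and $aP=\{ap:p\in P\}$. $J(S)=S-U(S)$, where $U(S)$ is the group of (two-sided) units of $S$. A proper right ideal $P$ is completely prime if for all $a,b\in S$, $ab\in P$ implies $a\in P$ or $b\in P$. For a proper right ideal $A$ of $S$, $P_r(A)=\{s\in S: xs\in A\text{ for some }x\in S-A\}$; this is a completely prime right ideal of $S$. For a completely prime right ideal $P$ put $T=S-P$ (set difference), and for $a\in S$ put $(aS)T^{-1}=\{x\in S: xt\in aS\text{ for some }t\in T\}$. $S$ is right $P$-comparable, where $P$ is completely prime and (by convention) a two-sided ideal, if for all $a,b\in S$ one of the following holds: $aS\subseteq bS$, $bS\subseteq aS$, or $(aS)T^{-1}=(bS)T^{-1}$. A proper right ideal $I$ of $S$ is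 a right waist if for every right ideal $A$ of $S$, either $A\subseteq I$ or $I\subset A$. *)

(* Defs.v *)
From HB Require Import structures.
From mathcomp Require Import all_boot.
From mathcomp Require Import boolp classical_sets.

Set Implicit Arguments.
Unset Strict Implicit.
Unset Printing Implicit Defensive.

Local Open Scope classical_set_scope.
Local Open Scope group_scope.

HB.mixin Record Monoid_hasZero S of Monoid S := {
  zerog : S;
  mul0g : forall x : S, zerog * x = zerog;
  mulg0 : forall x : S, x * zerog = zerog;
  oneg_neq0 : 1 <> zerog :> S
}.

(* A choice structure comes with every monoidType; it costs no generality, as
   boolp provides one on any type. *)
#[short(type="monoid0Type")]
HB.structure Definition Monoid0 := {S of Monoid_hasZero S & Monoid S}.

Notation "0" := (@zerog _) : group_scope.

Section Defs.
Variable S : monoid0Type.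
Implicit Types (a b c s t x : S) (A I P T : set S).

Definition left_cancellation_law : Prop :=
  forall a b c, a * b = a * c -> a * c <> 0 -> b = c.

Definition monoid_units : set S :=
  [set x | exists y : S, x * y = 1 /\ y * x = 1].

Definition nonunits : set S := [set: S] `\` monoid_units.

Definition right_ideal A : Prop :=
  A !=set0 /\ forall a s, A a -> A (a * s).

Definition left_ideal A : Prop :=
  A !=set0 /\ forall a s, A a -> A (s * a).

Definition two_sided_ideal A : Prop := right_ideal A /\ left_ideal A.

Definition proper_right_ideal A : Prop := right_ideal A /\ A <> [set: S].

Definition completely_prime P : Prop :=
  proper_right_ideal P /\ forall a b, P (a * b) -> P a \/ P b.

Definition left_translate a A : set S := [set a * p | p in A].

Definition principal_right a : set S := left_translate a [set: S].

(* P_r(A) *)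
Definition assoc_prime_right A : set S :=
  [set s | exists2 x, ([set: S] `\` A) x & A (x * s)].

(* A T^-1, a subset of S (no localization is formed) *)
Definition right_saturation A T : set S :=
  [set x | exists2 t, T t & A (x * t)].

Definition right_comparable P : Prop :=
  [/\ completely_prime P, two_sided_ideal P &
    forall a b,
      [\/ principal_right a `<=` principal_right b,
          principal_right b `<=` principal_right a |
          right_saturation (principal_right a) ([set: S] `\` P) =
          right_saturation (principal_right b) ([set: S] `\` P)]].

Definition right_waist I : Prop :=
  proper_right_ideal I /\
  forall A, right_ideal A -> A `<=` I \/ I `<` A.

End Defs.

Arguments left_cancellation_law S : clear implicits.
Arguments monoid_units S : clear implicits.
Arguments nonunits S : clear implicits.

(* Main.v *)
(** Write [Q = P_r(I)]. Comparability enters once: for [a] outside [I] and [b]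
    in [I], each of [aS `<=` bS] and [(aS)T^-1 = (bS)T^-1] would put some [a t] in [I]
    with [t] outside [Q], hence [a] in [I]; so [b] lies in [aS], and then in [aQ].
    Thus [I `<=` aQ] whenever [a] is outside [I], which gives both the waist
    property and [I = \bigcap_(a notin I) aQ], as left cancellation excludes
    [a] from [aQ]. *)

Require Import Defs.
From mathcomp Require Import all_boot.
From mathcomp Require Import boolp classical_sets.

Local Open Scope classical_set_scope.
Local Open Scope group_scope.

Section AssocPrime.
Set Implicit Arguments.
Unset Strict Implicit.
Variable S : monoid0Type.
Implicit Types (a b t x : S) (A I P : set S).

Lemma right_ideal0 A : right_ideal A -> A 0.
Proof. by move=> [[x Ax] Ars]; rewrite -(mulg0 x); exact: Ars. Qed.

Lemma proper_right_ideal_not1 A : proper_right_ideal A -> ~ A 1.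
Proof.
move=> [[_ Ars] AT] A1; apply: AT; apply/seteqP; split=> // x _.
by rewrite -(mul1g x); exact: Ars.
Qed.

Lemma proper_right_ideal_nonunits A :
  proper_right_ideal A -> A `<=` nonunits S.
Proof.
move=> propA x Ax; split=> // -[y [xy1 _]].
by apply: (proper_right_ideal_not1 propA); rewrite -xy1; apply: propA.1.2.
Qed.

(** The definition of [P_r(I)] read contrapositively, the form in which elements outside it are used
    below. *)
Lemma assoc_prime_right_cancel I x t :
  I (x * t) -> ~ assoc_prime_right I t -> I x.
Proof. by move=> Ixt nQt; apply: contrapT => nIx; apply: nQt; exists x. Qed.

Lemma sub_right_saturation A P : ~ P 1 ->
  A `<=` right_saturation A ([set: S] `\` P).
Proof. by move=> nP1 x Ax; exists 1 => //; rewrite mulg1. Qed.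

Lemma principal_right_refl a : principal_right a a.
Proof. by exists 1 => //; rewrite mulg1. Qed.

Lemma sub_left_translate_assoc_prime I a :
  right_ideal I -> right_comparable (assoc_prime_right I) -> ~ I a ->
  I `<=` left_translate a (assoc_prime_right I).
Proof.
move=> [_ Irs] [[propQ _] _ comp] nIa b Ib.
have bSI x : principal_right b x -> I x by move=> [s _ <-]; exact: Irs.
have aS := principal_right_refl a.
case: (comp a b) => [ab|ba|eqab].
- by case: nIa; apply/bSI/ab.
- have [s _ asb] := ba b (principal_right_refl b).
  (* The cofactor [s] is in [P_r(I)] because [a], outside [I], is a witness. *)
  by exists s => //; exists a => //; rewrite asb.
(* As [1] is outside [P_r(I)], [a] lies in its own saturation, hence in that of [b]. *)
- have : right_saturation (principal_right a)
      ([set: S] `\` assoc_prime_right I) a.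
    by apply: sub_right_saturation => //; exact: proper_right_ideal_not1.
  rewrite eqab => -[t [_ nQt] bSat].
  by case: nIa; apply: assoc_prime_right_cancel nQt; exact: bSI.
Qed.

Lemma bigcap_left_translate_assoc_prime I :
  left_cancellation_law S -> right_ideal I ->
  right_comparable (assoc_prime_right I) ->
  I = \bigcap_(a in ~` I) left_translate a (assoc_prime_right I).
Proof.
move=> hcancel idI comp; have [[propQ _] _ _] := comp.
apply/seteqP; split=> [b Ib a nIa|x capx].
  exact: sub_left_translate_assoc_prime Ib.
(* Outside [I], [x] is itself an index, so [x * q = x] with [q] in [P_r(I)]. Cancelling [x], nonzero
   since [0] is in [I], gives [q = 1]. *)
apply: contrapT => nIx; have [q Qq xqx] := capx x nIx.
apply: (proper_right_ideal_not1 propQ).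
suff <- : q = 1 by [].
apply: (hcancel x); rewrite mulg1 // => x0.
by apply: nIx; rewrite x0; exact: right_ideal0.
Qed.

(** Saturating adds nothing to [I]: if [x * t] is in [aS], inside [I], with [t] outside [P_r(I)],
    then [x] is in [I]. *)
Lemma bigcup_right_saturation_assoc_prime I :
  right_ideal I -> ~ assoc_prime_right I 1 ->
  I = \bigcup_(a in I) right_saturation (principal_right a)
        ([set: S] `\` assoc_prime_right I).
Proof.
move=> [_ Irs] nQ1; apply/seteqP; split=> [x Ix|x [a Ia [t [_ nQt] [s _ asxt]]]].
  by exists x => //; apply: sub_right_saturation => //; exact: principal_right_refl.
by apply: assoc_prime_right_cancel nQt; rewrite -asxt; exact: Irs.
Qed.

Lemma right_comparable_right_waist I :
  proper_right_ideal I -> right_comparable (assoc_prime_right I) ->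
  right_waist I.
Proof.
move=> propI comp; split=> // A [_ Ars].
have [AI|nAI] := pselect (A `<=` I); [by left | right; split=> //].
have [a Aa nIa] : exists2 a, A a & ~ I a.
  by apply: contrapT => nex; apply: nAI => a Aa;
     apply: contrapT => nIa; apply: nex; exists a.
(* [I] lies in [aQ], hence in [aS], hence in [A]. *)
move=> b /(sub_left_translate_assoc_prime propI.1 comp nIa) [s _ <-].
exact: Ars.
Qed.

End AssocPrime.

Theorem theorem3p13 (S : monoid0Type) (I : set S)
    (hcancel : left_cancellation_law S)
    (hI : proper_right_ideal I)
    (hI0 : I <> [set 0])
    (hcomp : right_comparable (assoc_prime_right I)) :
  [<-> assoc_prime_right I `<=` nonunits S;
       exists (P V : set S),
         [/\ completely_prime P, P `<=` nonunits S &
             I = \bigcap_(a in V) left_translate a P];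
       exists (P V' : set S),
         [/\ completely_prime P, P `<=` nonunits S &
             I = \bigcup_(a in V')
                   right_saturation (principal_right a) ([set: S] `\` P)]]
  /\ (assoc_prime_right I `<=` nonunits S -> right_waist I).
Proof.
have [idI _] := hI; have [primeQ _ _] := hcomp; have [propQ _] := primeQ.
(* The hypotheses already force (i): the proper right ideal P_r(I) contains no
   unit. So each condition is proved outright, with P = P_r(I). *)
have QJ := proper_right_ideal_nonunits propQ.
split; last by move=> _; exact: right_comparable_right_waist.
tfae=> // _; exists (assoc_prime_right I).
- by exists (~` I); split=> //; exact: bigcap_left_translate_assoc_prime.
- exists I; split=> //; apply: bigcup_right_saturation_assoc_prime => //.
  exact: proper_right_ideal_not1.
Qed.
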